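(* Suppose $X$ is a compact Hausdorff space, and $\{K_i\}_{i\in I}$ is a collection of closed subsets of $X$. If each $K_i$ is an $\eta$-space, then the closure of $\bigcup_{i\in I}K_i$ in $X$ is an $\eta$-space.
   Context: For a compact Hausdorff space $Y$, $C(Y)$ denotes the algebra of complex-valued continuous functions on $Y$. A map $T$ on $C(Y)$ is additive if $T(f+g)=T(f)+T(g)$ for all $f,g$; it is a multiplication if there is $a\in C(Y)$ with $T(f)=af$ for all $f\in C(Y)$; it is a local multiplication if for each $f\in C(Y)$ there is $a_f\in C(Y)$ with $T(f)=a_f f$. A compact Hausdorff space $Y$ is an $\eta$-space if every additive local multiplication on $C(Y)$ is a multiplication. Closed subsets of $X$ carry the subspace topology. *)

(* Defs.v *)
From HB Require Import structures.
From mathcomp Require Import all_boot all_order all_algebra.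
From mathcomp Require Import complex.
From mathcomp Require Import all_classical all_reals topology normedtype.

Set Implicit Arguments.
Unset Strict Implicit.
Unset Printing Implicit Defensive.

Import Order.TTheory GRing.Theory Num.Theory.
Import numFieldNormedType.Exports.

Local Open Scope classical_set_scope.
Local Open Scope ring_scope.

Section ContinuousRing.
Context {Y : topologicalType} {K : numFieldType}.
Implicit Types f g h : continuousType Y K.

Fact cts_opp_subproof f : continuous (fun y => - f y).
Proof. by move=> y; exact: (cvgN (cts_fun (s := f) y)). Qed.

Fact cts_add_subproof f g : continuous (fun y => f y + g y).
Proof. by move=> y; exact: (cvgD (cts_fun (s := f) y) (cts_fun (s := g) y)). Qed.

Fact cts_mul_subproof f g : continuous (fun y => f y * g y).
Proof. by move=> y; exact: (cvgM (cts_fun (s := f) y) (cts_fun (s := g) y)). Qed.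

Definition cts_zero : continuousType Y K := cst 0.
Definition cts_one : continuousType Y K := cst 1.
Definition cts_opp f : continuousType Y K := mkcts (@cts_opp_subproof f).
Definition cts_add f g : continuousType Y K := mkcts (@cts_add_subproof f g).
Definition cts_mul f g : continuousType Y K := mkcts (@cts_mul_subproof f g).

Fact cts_addA : associative cts_add.
Proof. by move=> f g h; apply/continuousEP => y; exact: addrA. Qed.
Fact cts_addC : commutative cts_add.
Proof. by move=> f g; apply/continuousEP => y; exact: addrC. Qed.
Fact cts_add0 : left_id cts_zero cts_add.
Proof. by move=> f; apply/continuousEP => y; exact: add0r. Qed.
Fact cts_addN : left_inverse cts_zero cts_opp cts_add.
Proof. by move=> f; apply/continuousEP => y; exact: addNr. Qed.

HB.instance Definition _ := GRing.isZmodule.Build (continuousType Y K)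
  cts_addA cts_addC cts_add0 cts_addN.

Fact cts_mulA : associative cts_mul.
Proof. by move=> f g h; apply/continuousEP => y; exact: mulrA. Qed.
Fact cts_mulC : commutative cts_mul.
Proof. by move=> f g; apply/continuousEP => y; exact: mulrC. Qed.
Fact cts_mul1 : left_id cts_one cts_mul.
Proof. by move=> f; apply/continuousEP => y; exact: mul1r. Qed.
Fact cts_mulDl : left_distributive cts_mul +%R.
Proof. by move=> f g h; apply/continuousEP => y; exact: mulrDl. Qed.

(* Only a [comPzRingType]: the ring is trivial when [Y] is empty. *)
HB.instance Definition _ := GRing.Zmodule_isComPzRing.Build (continuousType Y K)
  cts_mulA cts_mulC cts_mul1 cts_mulDl.

Lemma cts_addE f g (y : Y) : (f + g) y = f y + g y. Proof. by []. Qed.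
Lemma cts_mulE f g (y : Y) : (f * g) y = f y * g y. Proof. by []. Qed.

End ContinuousRing.

(* The complex numbers are [complex R]; the cast selects the topology induced
   by the modulus, which the library attaches to every [numFieldType]. *)
Notation Ccont R Y := (continuousType Y (complex R : numFieldType)).

Section EtaSpace.
Context (R : realType) (Y : topologicalType).
Implicit Type T : Ccont R Y -> Ccont R Y.

Definition additive_map T := {morph T : f g / f + g}.

Definition multiplication T := exists a : Ccont R Y, forall f, T f = a * f.

Definition local_multiplication T :=
  forall f, exists a : Ccont R Y, T f = a * f.

Definition eta_space :=
  [/\ compact [set: Y], hausdorff_space Y &
      forall T, additive_map T -> local_multiplication T -> multiplication T].

End EtaSpace.

(* Main.v *)
Require Import Defs.
From mathcomp Require Import all_boot all_order all_algebra.
From mathcomp Require Import all_classical all_reals topology normedtype.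
From mathcomp Require Import complex numfun.

(** An additive local multiplication [T] on [C(Y)] is local in a strong sense:
if [f] vanishes at a point, then so does [T f = a_f f], so by additivity
[(T f)(y)] depends only on the value [f y].  Suppose that a space [Z] maps to
[Y] by a continuous [j] for which every continuous function on [Z] is of the
form [f \o j].  Then [g |-> (T f) \o j], for any [f] with [f \o j = g], is a
well-defined map on [C(Z)], and it is again an additive local multiplication.
If [Z] is an eta-space it is a multiplication, and evaluating at [g = 1]
identifies the multiplier as [(T 1) \o j].  This is
[local_multiplication_along]: [T f = T 1 * f] on the image of [j].

For the theorem take [Y] the closure of the union and [j] the inclusion of
[K i].  Extension of functions from [K i] to [Y], indeed to all of [X], is
Tietze's theorem for the real and imaginary parts ([tietze_complex]).  Hence
[T f] and [T 1 * f] agree on every [K i]; they are continuous and the union is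
dense in [Y], so they agree on [Y] ([eq_on_closure_dense]). *)

Set Implicit Arguments.
Unset Strict Implicit.
Unset Printing Implicit Defensive.

Import Order.TTheory GRing.Theory Num.Theory.
Import numFieldNormedType.Exports.

Local Open Scope classical_set_scope.
Local Open Scope ring_scope.

Section Subtype.
Context {X : topologicalType}.
Implicit Types A U : set X.

Lemma set_type_compact A : compact A -> compact [set: A].
Proof.
move=> cA F PF _.
have FA : (set_val @ F) A.
  by apply: (@filterS _ F _ setT) => [y _|]; [exact: set_valP|exact: filterT].
have [x [Ax clx]] := cA _ _ FA.
exists (exist _ x (mem_set Ax)); split=> // P B FP.
move=> [_ [[W oW <-] Wx WB]].
have FvP : (set_val @ F) (set_val @` P).
  by apply: (@filterS _ F _ P) => // y Py; exists y.
have [_ [[y Py <-] Wy]] := clx _ _ FvP (open_nbhs_nbhs (conj oW Wx)).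
by exists y; split=> //; exact: WB.
Qed.

Lemma set_type_hausdorff A : hausdorff_space X -> hausdorff_space A.
Proof.
move=> hX x y clxy; apply: val_inj; apply: hX => P B xP yB.
have [z [Pz Bz]] := clxy _ _ (initial_continuous xP) (initial_continuous yB).
by exists (set_val z).
Qed.

(** Since [Z] is Hausdorff it suffices that neighbourhoods of [f x] and [g x]
always meet; they meet at the common value of [f] and [g] at a point of [U]
close to [x]. *)
Lemma eq_on_closure_dense (Z : topologicalType) U (f g : closure U -> Z) :
  hausdorff_space Z -> continuous f -> continuous g ->
  (forall x, U (set_val x) -> f x = g x) -> forall x, f x = g x.
Proof.
move=> hZ cf cg fgU x; apply: hZ => P B fxP gxB.
have [_ [[W oW <-] Wx WPB]] : nbhs x (f @^-1` P `&` g @^-1` B).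
  by apply: filterI; [exact: cf|exact: cg].
have [z [Uz Wz]] := set_mem (valP x) _ (open_nbhs_nbhs (conj oW Wx)).
pose z' : closure U := exist _ z (mem_set (@subset_closure _ U z Uz)).
have [Pz Bz] : (f @^-1` P `&` g @^-1` B) z' by exact: WPB.
by exists (f z'); split => //; rewrite (fgU z').
Qed.

End Subtype.

Section ComplexContinuity.
Context {R : realType}.
Local Notation C := (complex R : numFieldType).
Local Open Scope complex_scope.

Lemma continuous_real_complex : continuous (fun r : R => r%:C : C).
Proof.
move=> r; apply/cvgrPdist_lt => e e0.
(* The radius [e] is complex, but being positive it is real. *)
have e0' : 0 < complex.Re e by move: e0; rewrite ltcE => /andP[].
have eE : e = (complex.Re e)%:C.
  by case: e e0 {e0'} => a b; rewrite ltcE /= => /andP[/eqP -> _].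
near=> s; rewrite -rmorphB normc_def /= expr0n addr0 sqrtr_sqr eE ltcR.
by near: s; exact: cvgr_dist_lt.
Unshelve. all: by end_near. Qed.

Lemma normc_ge_Im (z : R[i]) : `|complex.Im z|%:C <= `|z|.
Proof.
by rewrite normc_def lecR -sqrtr_sqr ler_wsqrtr // lerDr sqr_ge0.
Qed.

(** The norm on [R[i]] takes its values in [R[i]], so a real-valued map is
compared with it through the embedding of [R]. *)
Lemma contraction_continuous (h : {additive C -> R}) :
  (forall z, `|h z|%:C <= `|z|) -> continuous (h : C -> R).
Proof.
move=> hle z.
apply/(@cvgrPdist_lt R R^o C (nbhs (z : C)) (nbhs_filter (z : C))) => e e0.
have /(nbhsx_ballx z) : 0 < e%:C :> C by rewrite ltcR.
apply: filterS => w zw; rewrite -raddfB -ltcR.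
exact: le_lt_trans (hle _) zw.
Qed.

Lemma continuous_Re : continuous (fun z : C => complex.Re z : R).
Proof. by apply: contraction_continuous => z; exact: normc_ge_Re. Qed.

Lemma continuous_Im : continuous (fun z : C => complex.Im z : R).
Proof. by apply: contraction_continuous => z; exact: normc_ge_Im. Qed.

End ComplexContinuity.

Section Tietze.
Context {R : realType} {X : topologicalType} (A : set X).
Hypotheses (X_compact : compact [set: X]) (X_hausdorff : hausdorff_space X).
Hypothesis A_closed : closed A.

(** The extension theorem for bounded functions applies because a continuous
function on the compact set [A] is bounded. *)
Lemma tietze_real (f : A -> R) : continuous f ->
  exists2 g : X -> R, continuous g & forall x : A, g (set_val x) = f x.
Proof.
move=> cf.
have cA : compact A by exact: subclosed_compact A_closed X_compact _.
have [M [_ fM]] : bounded_set (f @` [set: A]).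
  apply: (@compact_bounded R R^o).
  apply: continuous_compact; last exact: set_type_compact.
  exact: continuous_subspaceT.
have vL (x : A) : 'valL_(0 : R) f (set_val x) = f x.
  by rewrite -[LHS]/((sigL A \o 'valL_(0 : R)) f x) sigL_valL.
(* [fM] bounds [f] only by numbers strictly above [M], which may be negative. *)
have M1 : 0 < `|M| + 1 :> R by rewrite ltr_wpDl.
have [||g [fg cg _]] := @continuous_bounded_extension X R
  (compact_normal X_hausdorff X_compact) A A_closed
  ('valL_(0 : R) f) (`|M| + 1) M1.
- exact/subspace_valL_continuousP'.
- move=> x Ax; rewrite (vL (exist _ x (mem_set Ax))).
  apply: fM; last by exists (exist _ x (mem_set Ax)).
  by rewrite (le_lt_trans (ler_norm M)) // ltrDl.
by exists g => // x; rewrite -vL -fg //; exact: valP.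
Qed.

Lemma tietze_complex (f : Ccont R A) :
  exists g : Ccont R X, forall x : A, g (set_val x) = f x.
Proof.
have [|u cu uf] := @tietze_real (fun x => complex.Re (f x)).
  by move=> x; apply: continuous_comp; [exact: cts_fun|exact: continuous_Re].
have [|v cv vf] := @tietze_real (fun x => complex.Im (f x)).
  by move=> x; apply: continuous_comp; [exact: cts_fun|exact: continuous_Im].
pose emb w cw : Ccont R X := mkcts (fun x => continuous_comp (cw x)
  (@continuous_real_complex R (w x))).
pose iX : Ccont R X := cst 'i%C.
exists (emb u cu + iX * emb v cv) => x.
rewrite -[LHS]/((u (set_val x))%:C%C + 'i%C * (v (set_val x))%:C%C).
by rewrite uf vf -complexE.
Qed.

End Tietze.

Section Restriction.
Context {R : realType} {Y Z : topologicalType}.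
Implicit Types T : Ccont R Y -> Ccont R Y.

Definition pullback (j : Z -> Y) (j_cts : continuous j) (f : Ccont R Y) :
    Ccont R Z :=
  mkcts (fun z => continuous_comp (j_cts z) (cts_fun (s := f) (j z))).

(** When every function on [Z] extends along [j], [T] descends to an additive
local multiplication on [C(Z)], which the eta-property of [Z] forces to be the
multiplication by [T 1]. *)
Lemma local_multiplication_along T (j : Z -> Y) (j_cts : continuous j) :
  additive_map T -> local_multiplication T ->
  (forall g : Ccont R Z, exists f : Ccont R Y, forall z, f (j z) = g z) ->
  eta_space R Z -> forall f z, T f (j z) = T 1 (j z) * f (j z).
Proof.
move=> addT locT ext [_ _ etaZ].
have [e eE] := choice ext.
(* [T (f - g)] is a multiple of [f - g], hence vanishes where [f - g] does. *)
have T_eq (f g : Ccont R Y) :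
    (forall z, f (j z) = g (j z)) -> forall z, T f (j z) = T g (j z).
  move=> fg z; rewrite -[f](subrK g) addT cts_addE.
  have [a ->] := locT (f - g).
  by rewrite cts_mulE cts_addE fg -cts_addE subrr mulr0 add0r.
pose S g := pullback j_cts (T (e g)).
have addS : additive_map S.
  move=> g h; apply/continuousEP => z.
  rewrite -[RHS]/((T (e g) + T (e h)) (j z)) -addT; apply: T_eq => {}z.
  by rewrite cts_addE !eE.
have locS : local_multiplication S.
  move=> g; have [a Ta] := locT (e g); exists (pullback j_cts a).
  by apply/continuousEP => z; rewrite -[LHS]/(T (e g) (j z)) Ta !cts_mulE eE.
have [a Sa] := etaZ S addS locS.
have TE (f : Ccont R Y) z : T f (j z) = a z * f (j z).
  rewrite -[f (j z)]/(pullback j_cts f z) -cts_mulE -Sa.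
  by apply: T_eq => {}z; rewrite eE.
by move=> f z; rewrite !TE mulr1.
Qed.

End Restriction.

(* A set [A : set X] in a type position is the subtype [set_type A], with the
   subspace topology. *)
Theorem theorem3 (R : realType) (X : topologicalType)
    (X_compact : compact [set: X]) (X_hausdorff : hausdorff_space X)
    (I : Type) (K : I -> set X) (K_closed : forall i : I, closed (K i))
    (K_eta : forall i : I, eta_space R (K i)) :
  eta_space R (closure (\bigcup_(i in [set: I]) K i)).
Proof.
split; [|exact: set_type_hausdorff|].
  apply: set_type_compact.
  by apply: subclosed_compact X_compact _ => //; exact: closed_closure.
move=> T addT locT; exists (T 1) => f; apply/continuousEP.
apply: eq_on_closure_dense.
- exact: norm_hausdorff.
- exact: cts_fun.
- exact: cts_fun.
move=> x [i _ Kix].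
pose incl (z : K i) : closure (\bigcup_(i in [set: I]) K i) :=
  exist _ (set_val z) (mem_set
    (@subset_closure _ _ _ (ex_intro2 _ _ i Logic.I (set_valP z)))).
have incl_cts : continuous incl.
  by apply: continuous_comp_initial; exact: initial_continuous.
have xE : x = incl (exist _ (set_val x) (mem_set Kix)) by exact: val_inj.
rewrite cts_mulE xE.
apply: (local_multiplication_along incl_cts addT locT _ (K_eta i)) => g.
have [h hg] := tietze_complex X_compact X_hausdorff (K_closed i) g.
by exists (pullback (@initial_continuous _ _ set_val) h) => z; exact: hg.
Qed.
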